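(* Let $M:(0,\infty)^2\to(0,\infty)$ be a mean and let $r$ be a real function defined on $(0,\infty)$ with $\lim_{x\to\infty}r(x)=0$. Let $n\ge1$ be an integer. Then for fixed real numbers $\theta,\sigma$ (and $x>-\min(1,\theta,\sigma)$), the asymptotic formula for the polygamma function $\psi^{(n)}(x+1)\sim\frac{(-1)^{n-1}(n-1)!}{M^{n}(x+\theta,x+\sigma)}+r(x)$ holds as $x\to\infty$, in the sense that $$\lim_{x\to\infty}\left(\psi^{(n)}(x+1)-\frac{(-1)^{n-1}(n-1)!}{M(x+\theta,x+\sigma)^{n}}-r(x)\right)=0.$$
   Context: $\psi=\Gamma'/\Gamma$ is the psi (digamma) function, where $\Gamma$ is Euler's gamma function, and $\psi^{(n)}$ is its $n$-th derivative (a polygamma function). For an interval $I\subseteq\mathbb{R}$, a function $M:I^2\to\mathbb{R}$ is a (bivariate) mean if $\min(a,b)\le M(a,b)\le\max(a,b)$ for all $a,b\in I$. *)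

(* Defs.v *)
From HB Require Import structures.
From mathcomp Require Import all_boot all_order all_algebra.
From mathcomp Require Import all_classical all_reals all_analysis.

Set Implicit Arguments.
Unset Strict Implicit.
Unset Printing Implicit Defensive.

Import Order.TTheory GRing.Theory Num.Theory.
Import numFieldNormedType.Exports.

Local Open Scope classical_set_scope.
Local Open Scope ring_scope.

(* Euler's integral of the second kind. It converges only for [x > 0]; for
   [x <= 0] the Lebesgue integral is [+oo] and [Gamma x] is the junk value 0. *)
Definition Gamma (R : realType) (x : R) : R :=
  \int[@lebesgue_measure R]_(t in `]0, +oo[%classic) (t `^ (x - 1) * expR (- t)).

(* Meaningful on ]0, +oo[ only, like [Gamma]. As ]0, +oo[ is open, the iterated
   derivatives at its points do not depend on the junk values elsewhere. *)
Definition digamma (R : realType) (x : R) : R := (@Gamma R)^`()%classic x / Gamma x.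

Definition polygamma (R : realType) (n : nat) : R -> R := (@digamma R)^`(n)%classic.

(* A function on [I ^ 2] is represented by a total function, of which only the
   values on [I ^ 2] are constrained. *)
Definition bivariate_mean (R : realType) (I : interval R) (M : R -> R -> R) :
    Prop :=
  {in I &, forall a b, Num.min a b <= M a b <= Num.max a b}.

(* Main.v *)
(** If [X] is Gamma-distributed with parameter [x], then [polygamma n x] is the
    cumulant of order [n + 1] of [ln X].  For [n >= 1] it is unchanged when
    [ln X] is replaced with [ln X - c], so it is a polynomial without constant
    term in the moments [E (ln X - c) ^+ k], [k >= 1], for any real [c].
    For [c = ln x] these moments tend to 0 as [x] tends to [+oo], because
    [|y| ^+ k] is at most a multiple of [expR y + expR (- y) - 2] for [k >= 2],
    and [E (X / x) = 1] and [E (x / X) = x / (x - 1)] by the functional equation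
    of Gamma.  Hence [polygamma n] vanishes at infinity; so do [r] and the term
    with [M], since a mean of [x + theta] and [x + sigma] is at least their
    minimum. *)

Require Import Defs.
From HB Require Import structures.
From mathcomp Require Import all_boot all_order all_algebra.
From mathcomp Require Import all_classical all_reals all_analysis.
From mathcomp Require Import measurable_realfun ring lra.

Set Implicit Arguments.
Unset Strict Implicit.
Unset Printing Implicit Defensive.

Import Order.TTheory GRing.Theory Num.Theory.
Import numFieldNormedType.Exports.

Local Open Scope classical_set_scope.
Local Open Scope ring_scope.

(** * Integration and growth estimates on the open half-line *)

(** The integrand may blow up at 0, so the half-line is exhausted by the closed rays starting at
    1/(n+1). The fundamental theorem applies on each ray, and monotone convergence, which uses
    [f >= 0], gives the limit. *)
Lemma ge0_FTC_0y (R : realType) (f F : R -> R) (l0 ly : R) :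
  (forall t : R, 0 < t -> 0 <= f t) ->
  (forall t : R, 0 < t -> {for t, continuous (f : R -> R)}) ->
  (forall t : R, 0 < t -> is_derive (t : R) 1 (F : R -> R) (f t)) ->
  F t @[t --> 0^'+] --> l0 -> F t @[t --> +oo] --> ly ->
  (\int[lebesgue_measure]_(t in `]0%R, +oo[) (f t)%:E = (ly - l0)%:E)%E.
Proof.
move=> f_ge0 cf dF F0 Fy.
pose A (n : nat) : set R := `[n.+1%:R^-1 : R, +oo[%classic.
have AE : \bigcup_n A n = `]0, +oo[%classic.
  apply/seteqP; split => [t [n _]|t]; rewrite /A /= !in_itv/= !andbT.
    by apply: lt_le_trans; rewrite invr_gt0.
  move=> t0; have /ltr_add_invr[n] : 0 < t by [].
  by rewrite add0r => /ltW nt; exists n => //=; rewrite in_itv/= andbT.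
have A0 n t : A n t -> 0 < t.
  by rewrite /A/= in_itv/= andbT; apply: lt_le_trans; rewrite invr_gt0.
have ndA : nondecreasing_seq A.
  move=> m n mn; rewrite subsetEset => t; rewrite /A/= !in_itv/= !andbT.
  by apply: le_trans; rewrite lef_pV2 ?posrE// ler_nat.
have cont n : {within A n, continuous f}.
  by apply: continuous_in_subspaceT => t /set_mem /A0 /cf.
have mf n : measurable_fun (A n) f.
  apply: subspace_continuous_measurable_fun; first exact: measurable_itv.
  exact: cont.
have := @ge0_nondecreasing_set_cvg_integral _ _ _ _ _ (@lebesgue_measure R)
  ndA (fun=> measurable_itv _) (fun n => proj2 (measurable_EFinP _ _) (mf n)).
rewrite AE => h.
have {}h := h (fun i t Ait => ltac:(rewrite lee_fin; exact: f_ge0 (A0 _ _ Ait))).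
move/cvg_lim : (h) => <- //; apply/cvg_lim => //.
have inv0 n : 0 < n.+1%:R^-1 :> R by rewrite invr_gt0.
have -> : (fun n => \int[lebesgue_measure]_(x in A n) (f x)%:E)%E =
    (fun n => (ly - F n.+1%:R^-1)%:E)%E.
  apply/funext => n; rewrite EFinB; apply: ge0_continuous_FTC2y => //.
  - by move=> t nt; apply: f_ge0; exact: lt_le_trans nt.
  - exact: cont.
  - by move=> t nt; have [] := dF t (lt_trans (inv0 n) nt).
  - have := dF _ (inv0 n) => -[+ _].
    by move/derivable1_diffP/differentiable_continuous/cvg_at_right_filter.
  - move=> t; rewrite in_itv/= andbT => nt; have := dF t (lt_trans (inv0 n) nt).
    by move=> dFt; rewrite derive1E derive_val.
apply: cvg_EFin; first exact: nearW.
apply: cvgB; first exact: cvg_cst.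
move/cvg_at_rightP : F0; apply; split => //; exact: cvg_harmonic.
Qed.

(** For t <= 1 the power is at most 1. For t >= 1 it is at most t^(n+1) with n + 1 >= a, which is
    controlled by a single term of the exponential series. *)
Lemma powR_le_expR (R : realType) (a : R) : 0 <= a ->
  exists2 C : R, 0 < C & forall t, 0 < t -> t `^ a <= C * expR t.
Proof.
move=> a0; pose n := Num.truncn a.
have an : a <= n.+1%:R by rewrite ltW// truncnS_gt.
exists n.+1`!%:R; first by rewrite ltr0n fact_gt0.
move=> t t0; have nf1 : 1 <= n.+1`!%:R :> R by rewrite ler1n fact_gt0.
have [t1|/ltW t1] := leP t 1.
  apply: (@le_trans _ _ 1).
    have -> : 1 = 1 `^ a :> R by rewrite powR1.
    by rewrite ge0_ler_powR ?nnegrE// ltW.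
  by rewrite mulr_ege1// -expR0 ler_expR ltW.
apply: (@le_trans _ _ (t ^+ n.+1)).
  by rewrite -powR_mulrn ?(ltW t0)// ler_powR.
have := expR_ge1Dxn n (ltW t0).
by rewrite -lerBrDl ler_pdivrMr ?ltr0n ?fact_gt0// => /le_trans; apply; nra.
Qed.

Lemma cvgy_powR (R : realType) (x : R) : 0 < x -> t `^ x @[t --> +oo] --> +oo.
Proof.
move=> x0; apply/cvgryPge => A; near=> t.
have A1 : 0 <= Num.max A 0 by rewrite le_max lexx orbT.
apply: (@le_trans _ _ ((Num.max A 0 `^ x^-1) `^ x)).
  by rewrite -powRrM mulVf ?gt_eqF// powRr1// le_max lexx.
have At : Num.max A 0 `^ x^-1 <= t by near: t; apply: nbhs_pinfty_ge; rewrite num_real.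
by rewrite ge0_ler_powR ?nnegrE ?powR_ge0// ?(ltW x0)// (le_trans _ At)// powR_ge0.
Unshelve. all: by end_near. Qed.

Lemma continuous_powR (R : realType) (x t : R) : 0 < t ->
  {for t, continuous (fun t : R => t `^ x)}.
Proof.
move=> t0; apply/differentiable_continuous/derivable1_diffP.
by apply: derivable_powR; rewrite in_itv/= andbT.
Qed.

(** * The Gamma integrand and its integrability *)

Definition gamma_weight (R : realType) (x t : R) : R := t `^ (x - 1) * expR (- t).

Lemma gamma_weight_gt0 (R : realType) (x t : R) : 0 < t -> 0 < gamma_weight x t.
Proof. by move=> t0; rewrite mulr_gt0 ?powR_gt0 ?expR_gt0. Qed.

Lemma continuous_gamma_weight (R : realType) (x t : R) : 0 < t ->
  {for t, continuous (gamma_weight x)}.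
Proof.
move=> t0; apply: cvgM; first exact: continuous_powR.
apply: continuous_comp; first exact: opp_continuous.
exact: continuous_expR.
Qed.

(** The derivative of -1/(1 + t^x), so that for x > 0 its integral over the half-line is explicitly
    1. It behaves like the weight near 0, up to a constant, and decays only polynomially at
    infinity. *)
Definition gamma_majorant (R : realType) (x t : R) : R :=
  x * t `^ (x - 1) / (1 + t `^ x) ^+ 2.

Lemma gamma_majorant_ge0 (R : realType) (x t : R) : 0 < x ->
  0 <= gamma_majorant x t.
Proof.
by move=> x0; rewrite divr_ge0 ?exprn_ge0 ?addr_ge0 ?mulr_ge0 ?powR_ge0 ?ltW.
Qed.

Lemma onePpowR_gt0 (R : realType) (x t : R) : 0 < 1 + t `^ x.
Proof. by rewrite ltr_wpDr// powR_ge0. Qed.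

Lemma continuous_gamma_majorant (R : realType) (x t : R) : 0 < t ->
  {for t, continuous (gamma_majorant x)}.
Proof.
move=> t0; apply: cvgM.
  by apply: cvgM; [exact: cvg_cst|exact: continuous_powR].
apply: cvgV; first by rewrite expf_neq0// gt_eqF// onePpowR_gt0.
have c1 : {for t, continuous (fun t : R => 1 + t `^ x)}.
  by apply: cvgD; [exact: cvg_cst|exact: continuous_powR].
exact: (cvgM c1 c1).
Qed.

Lemma is_derive_gamma_majorant (R : realType) (x t : R) : 0 < t ->
  is_derive t 1 (fun t => - (1 + t `^ x)^-1) (gamma_majorant x t).
Proof.
move=> t0; have dt := @is_derive1_powR R x t t0.
have n0 : 1 + t `^ x != 0 by rewrite gt_eqF// onePpowR_gt0.
have dD : is_derive t 1 (fun t : R => 1 + t `^ x) (0 + x * t `^ (x - 1)).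
  exact: is_deriveD.
have := is_deriveN (@is_deriveV R (fun t => 1 + t `^ x) t _ 1 n0 dD).
move=> /is_derive_eq; apply.
rewrite /gamma_majorant add0r scaleNr opprK /GRing.scale/= -exprVn.
by rewrite mulrC.
Qed.

Lemma cvg_gamma_majorant0 (R : realType) (x : R) : 0 < x ->
  - (1 + t `^ x)^-1 @[t --> 0^'+] --> (-1 : R).
Proof.
move=> x0; apply: cvgN; rewrite -[X in _ --> X]invr1; apply: cvgV => //.
rewrite -[X in _ --> X]addr0; apply: cvgD; first exact: cvg_cst.
exact: powR_cvg0.
Qed.

Lemma cvg_gamma_majoranty (R : realType) (x : R) : 0 < x ->
  - (1 + t `^ x)^-1 @[t --> +oo] --> (0 : R).
Proof.
move=> x0; rewrite -[X in _ --> X]oppr0; apply: cvgN.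
apply/gtr0_cvgV0; first by near=> t; exact: onePpowR_gt0.
apply/cvgryPge => A; have /cvgryPge/(_ A) := cvgy_powR x0.
by apply: filterS => t /le_trans; apply; rewrite lerDr.
Unshelve. all: by end_near. Qed.

(** After cancelling t^(x-1), it remains to bound (1 + t^x)^2 = 1 + 2 t^x + t^(2x) by a multiple of
    exp t, term by term. Dividing the constant by x compensates for the factor x of the majorant. *)
Lemma gamma_weight_le_majorant (R : realType) (x : R) : 0 < x ->
  exists2 C : R, 0 < C &
    forall t, 0 < t -> gamma_weight x t <= C * gamma_majorant x t.
Proof.
move=> x0; have [C1 C10 h1] := powR_le_expR (ltW x0).
have [C2 C20 h2] := @powR_le_expR R (x * 2) (mulr_ge0 (ltW x0) (ler0n R 2)).
exists ((1 + 2 * C1 + C2) / x); first by rewrite divr_gt0// !addr_gt0// mulr_gt0.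
move=> t t0; have e1 : 1 <= expR t by rewrite -expR0 ler_expR ltW.
have := h1 t t0; have := h2 t t0.
rewrite powRrM (_ : _ `^ 2 = (t `^ x) ^+ 2); last first.
  by rewrite -powR_mulrn// powR_ge0.
move: (onePpowR_gt0 x t); set p := t `^ x => p0 H2 H1.
rewrite /gamma_weight /gamma_majorant -/p.
rewrite [leRHS](_ : _ = t `^ (x - 1) * ((1 + 2 * C1 + C2) / (1 + p) ^+ 2)); last first.
  by field; rewrite !gt_eqF.
rewrite ler_wpM2l ?powR_ge0// expRN ler_pdivlMr ?exprn_gt0//.
rewrite mulrC ler_pdivrMr ?expR_gt0//.
nra.
Qed.

Lemma measurable_fun_0y (R : realType) (f : R -> R) :
  (forall t, 0 < t -> {for t, continuous f}) -> measurable_fun `](0 : R), +oo[ f.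
Proof.
move=> cf; apply: open_continuous_measurable_fun; first exact: interval_open.
by move=> t; rewrite inE/= in_itv/= andbT; exact: cf.
Qed.

Lemma integrable_gamma_majorant (R : realType) (x : R) : 0 < x ->
  lebesgue_measure.-integrable `](0 : R)%R, +oo[ (EFin \o gamma_majorant x).
Proof.
move=> x0; apply/integrableP; split.
  apply/measurable_EFinP; apply: measurable_fun_0y => t; exact: continuous_gamma_majorant.
under eq_integral do rewrite /= ger0_norm ?gamma_majorant_ge0//.
have -> := ge0_FTC_0y (fun t _ => gamma_majorant_ge0 t x0)
  (@continuous_gamma_majorant R x) (@is_derive_gamma_majorant R x)
  (cvg_gamma_majorant0 x0) (cvg_gamma_majoranty x0).
by rewrite ltry.
Qed.

Lemma integrable_gamma_weight (R : realType) (x : R) : 0 < x ->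
  lebesgue_measure.-integrable `](0 : R)%R, +oo[ (EFin \o gamma_weight x).
Proof.
move=> x0; have [C C0 hC] := gamma_weight_le_majorant x0.
apply: le_integrable (integrableZl _ C (integrable_gamma_majorant x0)) => //=.
  apply/measurable_EFinP; apply: measurable_fun_0y => t; exact: continuous_gamma_weight.
move=> t; rewrite /= in_itv/= andbT => t0.
have w0 := ltW (gamma_weight_gt0 x t0); have h0 := gamma_majorant_ge0 t x0.
by rewrite lee_fin (ger0_norm w0) ger0_norm ?hC// mulr_ge0// ltW.
Qed.

Lemma integrable_EFinZl d (T : measurableType d) (R : realType)
    (mu : {measure set T -> \bar R}) (D : set T) (f : T -> R) (k : R) :
  measurable D -> mu.-integrable D (EFin \o f) ->
  mu.-integrable D (EFin \o (fun t => k * f t)).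
Proof. by move=> mD /(integrableZl mD k). Qed.

Lemma integrable_EFinD d (T : measurableType d) (R : realType)
    (mu : {measure set T -> \bar R}) (D : set T) (f g : T -> R) :
  measurable D -> mu.-integrable D (EFin \o f) ->
  mu.-integrable D (EFin \o g) -> mu.-integrable D (EFin \o (fun t => f t + g t)).
Proof. by move=> mD intf /(integrableD mD intf). Qed.

Lemma integrable_EFinB d (T : measurableType d) (R : realType)
    (mu : {measure set T -> \bar R}) (D : set T) (f g : T -> R) :
  measurable D -> mu.-integrable D (EFin \o f) ->
  mu.-integrable D (EFin \o g) -> mu.-integrable D (EFin \o (fun t => f t - g t)).
Proof. by move=> mD intf /(integrableB mD intf). Qed.

(** * Functional equation and positivity of Gamma *)

(** This is the integration by parts behind the functional equation: the two terms integrate to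
    [x * Gamma x] and [Gamma (x + 1)]. *)
Lemma is_derive_powR_expR (R : realType) (x t : R) : 0 < t ->
  is_derive t 1 (fun t => t `^ x * expR (- t))
    (x * gamma_weight x t - gamma_weight (x + 1) t).
Proof.
move=> t0; have dt := @is_derive1_powR R x t t0.
have de : is_derive t 1 (fun t : R => expR (- t)) (- expR (- t)).
  have d1 : is_derive t 1 (fun t : R => - t) (-1) by exact: is_deriveN.
  have d2 := @is_derive1_comp R (@expR R) (fun t => - t) t _ _ (is_derive_expR _) d1.
  by apply: (is_derive_eq d2); rewrite mulrN1.
have := @is_deriveM R R _ _ t 1 _ _ dt de.
move=> /is_derive_eq; apply.
by rewrite /gamma_weight addrK /GRing.scale/=; ring.
Qed.

Lemma cvg_powR_expR0 (R : realType) (x : R) : 0 < x ->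
  t `^ x * expR (- t) @[t --> 0^'+] --> (0 : R).
Proof.
move=> x0; rewrite -[X in _ --> X](mul0r (expR (- 0) : R)); apply: cvgM.
  exact: powR_cvg0.
apply: cvg_at_right_filter.
have : {for (0 : R), continuous (fun t : R => expR (- t))}.
  apply: continuous_comp; first exact: opp_continuous.
  exact: continuous_expR.
exact.
Qed.

Lemma cvg_powR_expRy (R : realType) (x : R) : 0 < x ->
  t `^ x * expR (- t) @[t --> +oo] --> (0 : R).
Proof.
(* Using the exponent x + 1 instead of x gains a factor t, so the function is at most C / t. *)
move=> x0; have [C C0 hC] := @powR_le_expR R (x + 1) (addr_ge0 (ltW x0) ler01).
apply/cvgr0Pnorm_le => e e0; near=> t.
have t0 : 0 < t by [].
have tC : C / e <= t by near: t; apply: nbhs_pinfty_ge; rewrite num_real.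
rewrite ger0_norm ?mulr_ge0 ?powR_ge0 ?expR_ge0// expRN ler_pdivrMr ?expR_gt0//.
have := hC t t0; rewrite powRD ?(gt_eqF t0) ?implybT// powRr1 ?(ltW t0)// => h.
rewrite -(ler_pM2r t0) (le_trans h)// mulrAC ler_pM2r ?expR_gt0//.
by rewrite -ler_pdivrMl// mulrC.
Unshelve. all: by end_near. Qed.

Lemma GammaS (R : realType) (x : R) : 0 < x -> Gamma (x + 1) = x * Gamma x.
Proof.
move=> x0; have x10 : 0 < x + 1 by rewrite addr_gt0.
have [K K0 hK] := gamma_weight_le_majorant x10.
have i1 := integrable_gamma_majorant x10.
have i2 := integrable_gamma_weight x0.
have i3 := integrable_gamma_weight x10.
have m1 : \int[lebesgue_measure]_(t in `]0%R, +oo[) gamma_majorant (x + 1) t = 1.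
  rewrite /Rintegral (ge0_FTC_0y (fun t _ => gamma_majorant_ge0 t x10)
    (@continuous_gamma_majorant R (x + 1)) (@is_derive_gamma_majorant R (x + 1))
    (cvg_gamma_majorant0 x10) (cvg_gamma_majoranty x10)).
  by rewrite /= sub0r opprK.
(* Adding a large multiple of the majorant makes the derivative of
   [t `^ x * expR (- t)] nonnegative. *)
pose f t := K * gamma_majorant (x + 1) t
  + (x * gamma_weight x t - gamma_weight (x + 1) t).
pose F t := K * - (1 + t `^ (x + 1))^-1 + t `^ x * expR (- t).
have f0 t : 0 < t -> 0 <= f t.
  move=> t0; rewrite /f; have := hK t t0; have := gamma_weight_gt0 x t0.
  by nra.
have cf t : 0 < t -> {for t, continuous f}.
  move=> t0; apply: cvgD.
    by apply: cvgM; [exact: cvg_cst|exact: continuous_gamma_majorant].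
  apply: cvgB; last exact: continuous_gamma_weight.
  by apply: cvgM; [exact: cvg_cst|exact: continuous_gamma_weight].
have dF (t : R) : 0 < t -> is_derive t 1 F (f t).
  move=> t0; have d1 := @is_derive_gamma_majorant R (x + 1) t t0.
  have d2 := is_derive_powR_expR x t0.
  exact: (is_deriveD (is_deriveZ K d1) d2).
have F0 : F t @[t --> 0^'+] --> - K.
  rewrite -[X in _ --> X]addr0 -(mulrN1 K); apply: cvgD; last exact: cvg_powR_expR0.
  by apply: cvgM; [exact: cvg_cst|exact: cvg_gamma_majorant0].
have Fy : F t @[t --> +oo] --> (0 : R).
  rewrite -[X in _ --> X]addr0 -[X in _ --> X + _](mulr0 K).
  apply: cvgD; last exact: cvg_powR_expRy.
  by apply: cvgM; [exact: cvg_cst|exact: cvg_gamma_majoranty].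
have := ge0_FTC_0y f0 cf dF F0 Fy => /(congr1 fine) /=.
rewrite -/(Rintegral _ _ _) /f.
rewrite RintegralD//; last 2 first.
- exact: integrable_EFinZl.
- by apply: integrable_EFinB => //; exact: integrable_EFinZl.
rewrite RintegralB//; last exact: integrable_EFinZl.
rewrite !RintegralZl// m1 mulr1 sub0r opprK.
(* The added majorant contributes K to the integral and K to the boundary values, so it cancels. *)
rewrite -/(Gamma x) -/(Gamma (x + 1)) => h.
by apply/eqP; rewrite eq_sym -subr_eq0; apply/eqP; lra.
Qed.

(** The integral is at least its part over [1, 2], where t^(x-1) >= 1/t >= 1/2 and exp(-t) >=
    exp(-2). *)
Lemma Gamma_gt0 (R : realType) (x : R) : 0 < x -> 0 < Gamma x.
Proof.
move=> x0; have iw := integrable_gamma_weight x0.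
have c0 : 0 < expR (- 2) / 2 :> R by rewrite divr_gt0 ?expR_gt0.
apply: (lt_le_trans c0); rewrite -lee_fin /Gamma /Rintegral fineK; last first.
  exact: (integrable_fin_num _ iw).
have sub : `[(1 : R), 2] `<=` `](0 : R), +oo[.
  by move=> t; rewrite /= !in_itv/= andbT => /andP[+ _]; apply: lt_le_trans.
have mw := measurable_int _ iw.
apply: (@le_trans _ _
  (\int[lebesgue_measure]_(t in `[1%R, 2%R]) (gamma_weight x t)%:E)%E); last first.
  apply: ge0_subset_integral => //= t; rewrite in_itv/= andbT => t0.
  by rewrite lee_fin ltW// gamma_weight_gt0.
apply: (@le_trans _ _
  (\int[lebesgue_measure]_(t in `[1%R, 2%R]) (expR (- 2) / 2)%:E)%E).
  rewrite integral_cst//= lebesgue_measure_itv/= lte_fin ltr1n -EFinB -EFinM lee_fin.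
  by rewrite (_ : 2 - 1 = 1 :> R) ?mulr1//; lra.
apply: ge0_le_integral => //=.
  exact: measurable_funS mw.
move=> t; rewrite in_itv/= => /andP[t1 t2]; rewrite lee_fin /gamma_weight mulrC.
rewrite ler_pM ?expR_ge0 ?invr_ge0 ?ler_expR ?lerN2//.
apply: (@le_trans _ _ (t `^ (-1))).
  by rewrite powR_inv1 ?lef_pV2 ?posrE ?(lt_le_trans _ t1) ?(le_trans _ t1).
by rewrite ler_powR// lerBrDl subrr ltW.
Qed.

(** * Logarithmic moments of the Gamma weight *)

Lemma exprn_le_fact_expR (R : realType) (y : R) (k : nat) : 0 <= y ->
  y ^+ k <= k`!%:R * expR y.
Proof.
move=> y0; case: k => [|k]; first by rewrite expr0 mul1r -expR0 ler_expR.
rewrite mulrC -ler_pdivrMr ?ltr0n ?fact_gt0//.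
by apply: le_trans (expR_ge1Dxn k y0); rewrite lerDr.
Qed.

Lemma gamma_weightD (R : realType) (x d t : R) : 0 < t ->
  gamma_weight (x + d) t = t `^ d * gamma_weight x t.
Proof.
move=> t0; rewrite /gamma_weight mulrA -powRD ?(gt_eqF t0) ?implybT//.
by congr (_ `^ _ * _); ring.
Qed.

(** The weight is monotone in its parameter, decreasing for t <= 1 and increasing for t >= 1, so one
    endpoint always dominates. The sum is a bound uniform over [a, b]. *)
Lemma gamma_weight_between (R : realType) (a b x t : R) : 0 < t -> a <= x <= b ->
  gamma_weight x t <= gamma_weight a t + gamma_weight b t.
Proof.
move=> t0 /andP[ax xb]; have wa := ltW (gamma_weight_gt0 a t0).
have wb := ltW (gamma_weight_gt0 b t0); have et := expR_ge0 (- t).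
have [t1|/ltW t1] := leP t 1.
  apply: (@le_trans _ _ (gamma_weight a t)); last by rewrite lerDl.
  by rewrite ler_wpM2r// ger_powR ?t0// lerD2r.
apply: (@le_trans _ _ (gamma_weight b t)); last by rewrite lerDr.
by rewrite ler_wpM2r// ler_powR// lerD2r.
Qed.

(** With y = |ln t - c|, the exponential series gives y^k <= k!/d^k exp(d y), and exp(d y) is at
    most exp(d |c|) times t^d or t^(-d), according to the sign of ln t - c. *)
Lemma norm_lnB_exprn_le (R : realType) (k : nat) (c d : R) : 0 < d ->
  exists2 C : R, 0 < C &
    forall t, 0 < t -> `|ln t - c| ^+ k <= C * (t `^ d + t `^ (- d)).
Proof.
move=> d0; exists (k`!%:R / d ^+ k * expR (d * `|c|)).
  by rewrite mulr_gt0 ?expR_gt0// divr_gt0 ?exprn_gt0// ltr0n fact_gt0.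
move=> t t0; have dy0 : 0 <= d * `|ln t - c| by rewrite mulr_ge0// ltW.
have := exprn_le_fact_expR k dy0; rewrite exprMn mulrC -ler_pdivlMr ?exprn_gt0//.
move=> /le_trans; apply; rewrite [leLHS]mulrAC -[leRHS]mulrA.
rewrite ler_wpM2l ?divr_ge0 ?exprn_ge0 ?(ltW d0)//.
have -> : t `^ d = expR (d * ln t) by rewrite /powR gt_eqF.
have -> : t `^ (- d) = expR (- d * ln t) by rewrite /powR gt_eqF.
have h1 := ler_norm c; have h2 := ler_norm (- c); rewrite normrN in h2.
have e1 := expR_gt0 (d * `|c| + d * ln t).
have e2 := expR_gt0 (d * `|c| + - d * ln t).
rewrite mulrDr -!expRD; case: (ger0P (ln t - c)) => h.
  apply: (@le_trans _ _ (expR (d * `|c| + d * ln t))); last by lra.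
  by rewrite ler_expR -mulrDr ler_pM2l//; lra.
apply: (@le_trans _ _ (expR (d * `|c| + - d * ln t))); last by lra.
by rewrite ler_expR mulNr -mulrBr ler_pM2l//; lra.
Qed.

(** The product of t^d + t^(-d) with the weights at x - d and x + d expands into the weights at x -
    2d, x (twice) and x + 2d; hence the factor 2 in the constant. The bound does not depend on y, as
    domination under the integral sign requires. *)
Lemma norm_lnB_exprn_gamma_weight_le (R : realType) (k : nat) (c d x : R) : 0 < d ->
  exists2 C : R, 0 < C &
    forall t y, 0 < t -> x - d <= y <= x + d ->
      `|ln t - c| ^+ k * gamma_weight y t <=
        C * (gamma_weight (x - 2 * d) t + gamma_weight x t
          + gamma_weight (x + 2 * d) t).
Proof.
move=> d0; have [C C0 hC] := norm_lnB_exprn_le k c d0.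
exists (2 * C); first by rewrite mulr_gt0.
move=> t y t0 xdy; have := hC t t0; have := gamma_weight_between t0 xdy.
have -> : x - 2 * d = x + (- d + - d) by ring.
have -> : x + 2 * d = x + (d + d) by ring.
have w0 := gamma_weight_gt0 x t0; have wy := gamma_weight_gt0 y t0.
rewrite !gamma_weightD// !powRD ?(gt_eqF t0) ?implybT//.
have : t `^ d * t `^ (- d) = 1.
  by rewrite -powRD ?(gt_eqF t0) ?implybT// subrr powRr0.
have : 0 < t `^ d by rewrite powR_gt0.
have : 0 < t `^ (- d) by rewrite powR_gt0.
move: (t `^ d) (t `^ (- d)) (gamma_weight x t) w0 (gamma_weight y t) wy.
move=> p q w w0 wy wy0 q0 p0 pq1 h1 h2.
apply: (@le_trans _ _ (C * (p + q) * (q * w + p * w))).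
  by rewrite ler_pM// ?exprn_ge0// ltW.
rewrite [leLHS](_ : _ = C * w * (p * p + q * q + 2 * (p * q))); last by ring.
rewrite [leRHS](_ : _ = C * w * (2 * (q * q + 1 + p * p))); last by ring.
by rewrite ler_pM2l ?mulr_gt0// pq1; nra.
Qed.

(** For X Gamma-distributed with parameter x, this is [Gamma x] times the moment E (ln X - c)^k;
    [gamma_ratio] is the moment itself. The centre c is a separate argument so that it stays fixed
    when differentiating in x. *)
Definition gamma_moment (R : realType) (k : nat) (c x : R) : R :=
  \int[@lebesgue_measure R]_(t in `]0%R, +oo[) ((ln t - c) ^+ k * gamma_weight x t).

Lemma continuous_lnB_exprn_gamma_weight (R : realType) (k : nat) (c x t : R) :
  0 < t -> {for t, continuous (fun t => (ln t - c) ^+ k * gamma_weight x t)}.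
Proof.
move=> t0; apply: cvgM; last exact: continuous_gamma_weight.
have : {for t, continuous (fun t : R => ln t - c)}.
  by apply: cvgB; [exact: continuous_ln|exact: cvg_cst].
move=> h; exact: (continuous_comp h (@exprn_continuous R k _)).
Qed.

(** The choice d = x / 3 keeps the lowest parameter x - 2d = x / 3 positive. *)
Lemma integrable_log_majorant (R : realType) (C x : R) : 0 < x ->
  lebesgue_measure.-integrable `](0 : R)%R, +oo[
    (EFin \o (fun t => C * (gamma_weight (x - 2 * (x / 3)) t + gamma_weight x t
                            + gamma_weight (x + 2 * (x / 3)) t))).
Proof.
move=> x0; have i1 : 0 < x - 2 * (x / 3) by lra.
have i2 : 0 < x + 2 * (x / 3) by lra.
apply: integrable_EFinZl => //; apply: integrable_EFinD => //.
  by apply: integrable_EFinD => //; exact: integrable_gamma_weight.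
exact: integrable_gamma_weight.
Qed.

Lemma integrable_gamma_moment (R : realType) (k : nat) (c x : R) : 0 < x ->
  lebesgue_measure.-integrable `](0 : R)%R, +oo[
    (EFin \o (fun t => (ln t - c) ^+ k * gamma_weight x t)).
Proof.
move=> x0; have d0 : 0 < x / 3 by rewrite divr_gt0.
have [C C0 hC] := norm_lnB_exprn_gamma_weight_le k c x d0.
have := integrable_log_majorant C x0; apply: le_integrable => //.
  apply/measurable_EFinP; apply: measurable_fun_0y => t.
  exact: continuous_lnB_exprn_gamma_weight.
move=> t; rewrite /= in_itv/= andbT => t0; rewrite lee_fin.
rewrite normrM normrX (ger0_norm (ltW (gamma_weight_gt0 x t0))).
by apply: (le_trans _ (ler_norm _)); apply: hC => //; lra.
Qed.

Lemma is_derive_gamma_weight (R : realType) (x t : R) : 0 < t ->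
  is_derive x 1 (fun x : R => gamma_weight x t) (ln t * gamma_weight x t).
Proof.
move=> t0.
have -> : (fun x : R => gamma_weight x t) =
    (fun x : R => expR ((x - 1) * ln t) * expR (- t)).
  by apply/funext => y; rewrite /gamma_weight /powR gt_eqF.
have d1 : is_derive x 1 (fun x : R => (x - 1) * ln t) (ln t).
  have d0 := is_deriveB (is_derive_id x (1 : R)) (is_derive_cst (1 : R) x 1).
  have := @is_deriveM R R _ _ x 1 _ _ d0 (is_derive_cst (ln t) x 1).
  by move=> /is_derive_eq; apply; rewrite /GRing.scale/=; ring.
have d2 := @is_derive1_comp R (@expR R) (fun x => (x - 1) * ln t) x _ _
  (is_derive_expR _) d1.
have d3 := @is_deriveM R R _ _ x 1 _ _ d2 (is_derive_cst (expR (- t)) x 1).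
apply: (is_derive_eq d3); rewrite /gamma_weight /powR gt_eqF// /GRing.scale/=.
by ring.
Qed.

(** * Differentiation of the moments under the integral sign *)

(** Differentiating the weight in x brings down ln t = (ln t - c) + c, which accounts for the two
    terms. *)
Lemma is_derive_gamma_moment (R : realType) (k : nat) (c x : R) : 0 < x ->
  is_derive x 1 (gamma_moment k c) (gamma_moment k.+1 c x + c * gamma_moment k c x).
Proof.
move=> x0; have d0 : 0 < x / 3 by rewrite divr_gt0.
pose f x t := (ln t - c) ^+ k * gamma_weight x t : R.
have dfE (y t : R) : 0 < t -> is_derive y 1 (f ^~ t)
    ((ln t - c) ^+ k.+1 * gamma_weight y t + c * ((ln t - c) ^+ k * gamma_weight y t)).
  move=> t0; have d1 := is_derive_gamma_weight y t0.
  have := is_deriveZ ((ln t - c) ^+ k) d1.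
  move=> /is_derive_eq; apply.
  by rewrite exprS /GRing.scale/=; ring.
have [C1 C10 hC1] := norm_lnB_exprn_gamma_weight_le k.+1 c x d0.
have [C2 C20 hC2] := norm_lnB_exprn_gamma_weight_le k c x d0.
(* Dominates the derivative for all y within x / 3 of x: [C1] handles the moment of order k + 1 and
   [|c| * C2] the term with factor c. *)
pose G t := (C1 + `|c| * C2) * (gamma_weight (x - 2 * (x / 3)) t + gamma_weight x t
          + gamma_weight (x + 2 * (x / 3)) t).
have G0 t : 0 <= G t.
  apply: mulr_ge0; first by rewrite addr_ge0 ?mulr_ge0// ltW.
  by rewrite !addr_ge0// mulr_ge0 ?powR_ge0 ?expR_ge0.
have iG := integrable_log_majorant (C1 + `|c| * C2) x0.
have Ix : `](x - x / 3), (x + x / 3)[%classic x by rewrite /= in_itv/=; lra.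
have intf y : `](x - x / 3), (x + x / 3)[%classic y ->
    lebesgue_measure.-integrable `](0 : R)%R, +oo[ (EFin \o f y).
  rewrite /= in_itv/= => /andP[y1 y2]; apply: integrable_gamma_moment; lra.
have derf y t : `](x - x / 3), (x + x / 3)[%classic y ->
    `](0 : R), +oo[%classic t ->
    derivable (f ^~ t) y 1.
  by move=> _; rewrite /= in_itv/= andbT => t0; have [] := dfE y t t0.
have Gub y t : `](x - x / 3), (x + x / 3)[%classic y ->
    `](0 : R), +oo[%classic t ->
    `|partial1of2 f y t| <= G t.
  rewrite /= !in_itv/= andbT => /andP[y1 y2] t0.
  have yI : x - x / 3 <= y <= x + x / 3 by rewrite !ltW.
  rewrite partial1of2E (@derive_val _ _ _ _ _ _ _ (dfE y t t0)).
  rewrite (le_trans (ler_normD _ _))// (normrM c) !(normrM (_ ^+ _)) !normrX.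
    rewrite (ger0_norm (ltW (gamma_weight_gt0 y t0))) /G mulrDl.
  by rewrite lerD ?hC1// -mulrA ler_wpM2l// hC2.
apply: DeriveDef.
  exact: (derivable_under_integral _ Ix intf derf G0 iG Gub).
rewrite -derive1E.
rewrite (differentiation_under_integral _ Ix intf derf G0 iG Gub)//.
rewrite /gamma_moment -RintegralZl//; last exact: integrable_gamma_moment.
rewrite -RintegralD//; last 2 first.
- exact: integrable_gamma_moment.
- by apply: integrable_EFinZl => //; exact: integrable_gamma_moment.
apply: eq_Rintegral => t; rewrite inE/= in_itv/= andbT => t0.
by rewrite partial1of2E (@derive_val _ _ _ _ _ _ _ (dfE x t t0)).
Qed.

Lemma gamma_moment0 (R : realType) (c : R) : gamma_moment 0 c = @Gamma R.
Proof.
by apply/funext => x; apply: eq_Rintegral => t _; rewrite expr0 mul1r.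
Qed.

Definition gamma_ratio (R : realType) (k : nat) (c x : R) : R :=
  gamma_moment k c x / Gamma x.

Lemma is_derive_Gamma (R : realType) (c x : R) : 0 < x ->
  is_derive x 1 (@Gamma R) (gamma_moment 1 c x + c * Gamma x).
Proof.
by move=> x0; have := is_derive_gamma_moment 0 c x0; rewrite gamma_moment0.
Qed.

Lemma digammaE (R : realType) (c x : R) : 0 < x ->
  digamma x = gamma_ratio 1 c x + c.
Proof.
move=> x0; rewrite /digamma derive1E.
rewrite (@derive_val _ _ _ _ _ _ _ (is_derive_Gamma c x0)) /gamma_ratio.
by rewrite mulrDl mulfK// gt_eqF// Gamma_gt0.
Qed.

(** In the quotient rule the terms with factor c, from the numerator and from Gamma, cancel. Hence
    the derivative is again a polynomial in the ratios, with no explicit c. *)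
Lemma is_derive_gamma_ratio (R : realType) (k : nat) (c x : R) : 0 < x ->
  is_derive x 1 (gamma_ratio k c)
    (gamma_ratio k.+1 c x - gamma_ratio k c x * gamma_ratio 1 c x).
Proof.
move=> x0; have G0 : Gamma x != 0 by rewrite gt_eqF// Gamma_gt0.
have dG := is_derive_Gamma c x0; have dm := is_derive_gamma_moment k c x0.
have dV := @is_deriveV R (@Gamma R) x _ 1 G0 dG.
have := @is_deriveM R R _ _ x 1 _ _ dm dV.
move=> /is_derive_eq; apply.
by rewrite /gamma_ratio /GRing.scale/=; field.
Qed.

(** * Decay of the moments centred at [ln x] *)

Lemma subr_expRN_ge (R : realType) (u : R) (k : nat) : 0 <= u ->
  u ^+ k.+1 <= k.+1`!%:R * (expR u - expR (- u)).
Proof.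
move=> u0; rewrite mulrC -ler_pdivrMr ?ltr0n ?fact_gt0//.
have := expR_ge1Dxn k u0; have : expR (- u) <= 1 by rewrite -expR0 ler_expR oppr_le0.
by lra.
Qed.

(** The right-hand side vanishes to order 2 at y = 0, which is why the exponent starts at 2; the
    first moment needs a separate argument. *)
Lemma norm_exprn_le_cosh (R : realType) (k : nat) (y : R) :
  `|y| ^+ k.+2 <= 2 ^+ k.+2 * k.+1`!%:R * (expR y + expR (- y) - 2).
Proof.
have -> : expR y + expR (- y) = expR `|y| + expR (- `|y|).
  by case: (ger0P y) => // _; rewrite opprK addrC.
move: (normr_ge0 y); move: `|y| => {}z z0.
have u0 : 0 <= z / 2 by rewrite divr_ge0.
have h1 := subr_expRN_ge 0 u0; have h2 := subr_expRN_ge k u0.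
(* Split [u ^+ k.+2], where [u = z / 2], between the two factors of
   [(expR u - expR (- u)) ^+ 2]. *)
have -> : expR z + expR (- z) - 2 = (expR (z / 2) - expR (- (z / 2))) ^+ 2.
  have -> : expR z = expR (z / 2) ^+ 2 by rewrite -expRM_natl; congr expR; field.
  have -> : expR (- z) = expR (- (z / 2)) ^+ 2.
    by rewrite -expRM_natl; congr expR; field.
  have : expR (z / 2) * expR (- (z / 2)) = 1 by rewrite -expRD subrr expR0.
  by move: (expR _) (expR _) => p q pq; rewrite sqrrB pq; ring.
have -> : z ^+ k.+2 = 2 ^+ k.+2 * ((z / 2) ^+ 1 * (z / 2) ^+ k.+1).
  by rewrite -exprD add1n -exprMn mulrC divfK.
rewrite -mulrA ler_wpM2l ?exprn_ge0// expr2 mulrCA ler_pM ?exprn_ge0//.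
by move: h1; rewrite mul1r.
Qed.

Section moment_bound.
Context (R : realType) (x : R) (x1 : 1 < x).

Let x0 : 0 < x. Proof. exact: lt_trans x1. Qed.
Let xB10 : 0 < x - 1. Proof. by rewrite subr_gt0. Qed.
Let x10 : 0 < x + 1. Proof. by rewrite addr_gt0. Qed.

(* The weight times [t / x - 1] and [x / t - 1] respectively. *)
Let U t := x^-1 * gamma_weight (x + 1) t - gamma_weight x t.
Let L t := x * gamma_weight (x - 1) t - gamma_weight x t.

Let iU : lebesgue_measure.-integrable `](0 : R)%R, +oo[ (EFin \o U).
Proof.
apply: integrable_EFinB => //; last exact: integrable_gamma_weight.
by apply: integrable_EFinZl => //; exact: integrable_gamma_weight.
Qed.

Let iL : lebesgue_measure.-integrable `](0 : R)%R, +oo[ (EFin \o L).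
Proof.
apply: integrable_EFinB => //; last exact: integrable_gamma_weight.
by apply: integrable_EFinZl => //; exact: integrable_gamma_weight.
Qed.

Let intU : \int[lebesgue_measure]_(t in `]0%R, +oo[) U t = 0.
Proof.
rewrite RintegralB//; last 2 first.
- by apply: integrable_EFinZl => //; exact: integrable_gamma_weight.
- exact: integrable_gamma_weight.
rewrite RintegralZl//; last exact: integrable_gamma_weight.
by rewrite -/(Gamma (x + 1)) -/(Gamma x) GammaS// mulKf ?subrr// gt_eqF.
Qed.

(** The functional equation at x - 1, positive since x > 1, turns the first term into x / (x - 1)
    times [Gamma x], and x / (x - 1) - 1 = 1 / (x - 1). *)
Let intL : \int[lebesgue_measure]_(t in `]0%R, +oo[) L t = Gamma x / (x - 1).
Proof.
rewrite RintegralB//; last 2 first.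
- by apply: integrable_EFinZl => //; exact: integrable_gamma_weight.
- exact: integrable_gamma_weight.
rewrite RintegralZl//; last exact: integrable_gamma_weight.
rewrite -/(Gamma (x - 1)) -/(Gamma x).
have := GammaS xB10; rewrite subrK => ->.
by field; rewrite gt_eqF.
Qed.

Let UE t : 0 < t -> U t = (expR (ln t - ln x) - 1) * gamma_weight x t.
Proof.
move=> t0; rewrite /U gamma_weightD// powRr1 ?ltW// expRB !lnK ?posrE//.
by field; rewrite gt_eqF.
Qed.

Let LE t : 0 < t -> L t = (expR (- (ln t - ln x)) - 1) * gamma_weight x t.
Proof.
move=> t0; rewrite /L gamma_weightD// powR_inv1 ?ltW// opprB expRB !lnK ?posrE//.
by field; rewrite gt_eqF.
Qed.

(** Put y = ln t - ln x. For the first moment, 1 - exp(-y) <= y <= exp y - 1 places the integral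
    between those of [- L] and [U]. For higher moments, exp y + exp(-y) - 2 times the weight is
    [U + L], whose integral is [Gamma x / (x - 1)]. *)
Lemma norm_gamma_ratio_le (k : nat) : `|gamma_ratio k.+1 (ln x) x|
  <= 2 ^+ k.+1 * k`!%:R / (x - 1).
Proof.
have G0 := Gamma_gt0 x0.
rewrite normrM normfV (gtr0_norm G0) ler_pdivrMr// [leRHS]mulrAC -[leRHS]mulrA.
have im := integrable_gamma_moment k.+1 (ln x) x0.
case: k im => [|k] im.
  rewrite fact0 !expr1 mulr1.
  have GL0 : 0 <= Gamma x / (x - 1) by rewrite divr_ge0// ltW.
  apply: (@le_trans _ _ (Gamma x / (x - 1))); last by lra.
  rewrite ler_norml; apply/andP; split; last first.
    apply: le_trans GL0; rewrite -intU; apply: le_Rintegral => // t.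
    rewrite /= in_itv/= andbT => t0; rewrite UE// expr1.
    rewrite ler_wpM2r ?(ltW (gamma_weight_gt0 _ _))//.
    by rewrite lerBrDl expR_ge1Dx.
  rewrite -intL -mulN1r -RintegralZl//; apply: le_Rintegral => //.
    exact: integrable_EFinZl.
  move=> t; rewrite /= in_itv/= andbT => t0; rewrite LE// expr1 mulrA.
  rewrite ler_wpM2r ?(ltW (gamma_weight_gt0 _ _))//.
  by have := expR_ge1Dx (- (ln t - ln x)); lra.
rewrite -[Gamma x / (x - 1)]add0r -intU -intL -RintegralD// -RintegralZl//; last first.
  exact: integrable_EFinD.
apply: (le_trans (le_normr_Rintegral _ im)) => //.
apply: le_Rintegral => //.
- exact: integrable_norm.
- by apply: integrable_EFinZl => //; exact: integrable_EFinD.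
move=> t; rewrite /= in_itv/= andbT => t0; rewrite UE// LE// -mulrDl mulrA.
rewrite (normrM (_ ^+ _)) normrX (gtr0_norm (gamma_weight_gt0 x t0)).
rewrite ler_wpM2r ?(ltW (gamma_weight_gt0 _ _))//.
by rewrite (le_trans (norm_exprn_le_cosh _ _))// ler_wpM2l//; lra.
Qed.

End moment_bound.

Lemma cvg_gamma_ratio (R : realType) (k : nat) :
  gamma_ratio k.+1 (ln x) x @[x --> +oo] --> (0 : R).
Proof.
apply/cvgr0Pnorm_le => e e0; near=> x.
have x1 : 1 < x by near: x; apply: nbhs_pinfty_gt; rewrite num_real.
have x2 : 1 + 2 ^+ k.+1 * k`!%:R / e <= x.
  by near: x; apply: nbhs_pinfty_ge; rewrite num_real.
apply: (le_trans (norm_gamma_ratio_le x1 k)).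
by rewrite ler_pdivrMr ?subr_gt0// -ler_pdivrMl// mulrC lerBrDl.
Unshelve. all: by end_near. Qed.

(** * Polygamma functions as polynomials in the centred moments *)

(* Polynomials without constant term in the ratios [gamma_ratio k c x], [k >= 1];
   [c] is the centering constant, and differentiation is with respect to [x]. *)
Inductive cumulant_like (R : realType) : (R -> R -> R) -> Prop :=
| cumulant_like_ratio k : cumulant_like (@gamma_ratio R k.+1)
| cumulant_likeB f g : cumulant_like f -> cumulant_like g ->
    cumulant_like (fun c x => f c x - g c x)
| cumulant_likeD f g : cumulant_like f -> cumulant_like g ->
    cumulant_like (fun c x => f c x + g c x)
| cumulant_likeM f g : cumulant_like f -> cumulant_like g ->
    cumulant_like (fun c x => f c x * g c x).

Lemma cumulant_like_derive (R : realType) (f : R -> R -> R) : cumulant_like f ->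
  exists2 g, cumulant_like g &
    forall c x, 0 < x -> is_derive (x : R) 1 (f c) (g c x).
Proof.
elim=> [k|{}f g _ [f' cf' df] _ [g' cg' dg]|{}f g _ [f' cf' df] _ [g' cg' dg]
       |{}f g cf [f' cf' df] cg [g' cg' dg]].
- exists (fun c x => gamma_ratio k.+2 c x - gamma_ratio k.+1 c x * gamma_ratio 1 c x).
    by do ?constructor.
  by move=> c x; exact: is_derive_gamma_ratio.
- exists (fun c x => f' c x - g' c x); first exact: cumulant_likeB.
  by move=> c x x0; exact: (is_deriveB (df c x x0) (dg c x x0)).
- exists (fun c x => f' c x + g' c x); first exact: cumulant_likeD.
  by move=> c x x0; exact: (is_deriveD (df c x x0) (dg c x x0)).
- exists (fun c x => f c x * g' c x + g c x * f' c x).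
    by apply: cumulant_likeD; exact: cumulant_likeM.
  by move=> c x x0; exact: (is_deriveM (df c x x0) (dg c x x0)).
Qed.

(** The centre is set to [ln x] only here, after all differentiations at fixed c. Every ratio tends
    to 0, and sums, differences and products preserve this. *)
Lemma cumulant_like_cvg (R : realType) (f : R -> R -> R) : cumulant_like f ->
  f (ln x) x @[x --> +oo] --> (0 : R).
Proof.
elim=> [k|{}f g _ f0 _ g0|{}f g _ f0 _ g0|{}f g _ f0 _ g0].
- exact: cvg_gamma_ratio.
- by rewrite -[X in _ --> X](subr0 0); exact: cvgB.
- by rewrite -[X in _ --> X](addr0 0); exact: cvgD.
- by rewrite -[X in _ --> X](mulr0 0); exact: cvgM.
Qed.

(** A single f serves for every centre c, so c may later be chosen depending on x. The additive c at
    order 0 comes from ln t = (ln t - c) + c and disappears with the first derivative. *)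
Lemma polygamma_cumulant_like (R : realType) (n : nat) :
  exists2 f, @cumulant_like R f &
    forall c x, 0 < x -> polygamma n x = f c x + (if n is 0 then c else 0).
Proof.
elim: n => [|n [f cf fE]].
  by exists (@gamma_ratio R 1); [constructor|move=> c x; exact: digammaE].
have [g cg df] := cumulant_like_derive cf; exists g => // c x x0.
rewrite addr0 /polygamma derive1nS derive1E.
(* The induction hypothesis holds only for positive arguments, but these form a neighbourhood of x,
   which is enough to compare derivatives. *)
rewrite (@near_eq_derive _ _ _ _ (fun x => f c x + (if n is 0 then c else 0))).
  have d := df c x x0.
  have := is_deriveD d (is_derive_cst (if n is 0 then c else 0) x 1).
  by rewrite addr0 => h; rewrite (@derive_val _ _ _ _ _ _ _ h).
near=> y; apply: fE; near: y; exact: lt_nbhsr.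
Unshelve. all: by end_near. Qed.

Lemma cvg_polygamma (R : realType) (n : nat) :
  polygamma n.+1 x @[x --> +oo] --> (0 : R).
Proof.
have [f cf fE] := polygamma_cumulant_like R n.+1.
apply: cvg_trans (cumulant_like_cvg cf); apply: near_eq_cvg; near=> x.
by rewrite (fE (ln x)) ?addr0.
Unshelve. all: by end_near. Qed.

(** * The asymptotic formula *)

Theorem theorem5 (R : realType) (M : R -> R -> R)
    (M_gt0 : {in `]0, +oo[ &, forall a b : R, 0 < M a b})
    (M_mean : bivariate_mean `]0, +oo[ M)
    (r : R -> R) (r_cvg0 : r x @[x --> +oo] --> (0 : R))
    (n : nat) (n_ge1 : (1 <= n)%N) (theta sigma : R) :
  (polygamma n (x + 1)
     - (- 1) ^+ n.-1 * (n.-1)`!%:R / M (x + theta) (x + sigma) ^+ n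
     - r x) @[x --> +oo] --> (0 : R).
Proof.
case: n n_ge1 => // n _.
have sy (a : R) : x + a @[x --> +oo] --> +oo.
  apply/cvgryPge => A; near=> x; rewrite -lerBlDr.
  by near: x; apply: nbhs_pinfty_ge; rewrite num_real.
have psi0 : polygamma n.+1 (x + 1) @[x --> +oo] --> (0 : R).
  exact: cvg_comp (sy 1) (@cvg_polygamma R n).
have inI (a x : R) : 0 < x + a -> x + a \in `]0, +oo[ by rewrite in_itv/= andbT.
have M0 : \forall x \near +oo, 0 < M (x + theta) (x + sigma).
  near=> x; apply: M_gt0; apply: inI; near: x; exact: (cvgry_gt (sy _)).
have My : M (x + theta) (x + sigma) @[x --> +oo] --> +oo.
  apply/cvgryPge => A; near=> x.
  have h1 : x + theta \in `]0, +oo[.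
    by apply: inI; near: x; exact: (cvgry_gt (sy _)).
  have h2 : x + sigma \in `]0, +oo[.
    by apply: inI; near: x; exact: (cvgry_gt (sy _)).
  have /andP[+ _] := M_mean _ _ h1 h2; apply: le_trans.
  by rewrite le_min; apply/andP; split; near: x; exact: (cvgry_ge (sy _)).
have MV0 : (M (x + theta) (x + sigma))^-1 @[x --> +oo] --> (0 : R).
  exact/gtr0_cvgV0.
have MX0 : (M (x + theta) (x + sigma) ^+ n.+1)^-1 @[x --> +oo] --> (0 : R).
  (* The limit 0 is written as a power of 0 with positive exponent, so that continuity of the power
     map at 0 applies to 1/M. *)
  rewrite -[X in _ --> X](expr0n R n.+1).
  have := cvg_comp _ _ MV0 (@exprn_continuous R n.+1 0).
  by apply: cvg_trans; apply: near_eq_cvg; near=> x; rewrite /= exprVn.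
rewrite -[X in _ --> X](subr0 0); apply: cvgB r_cvg0.
rewrite -[X in _ --> X](subr0 0); apply: cvgB; first exact: psi0.
rewrite -[X in _ --> X](mulr0 ((-1) ^+ n * n`!%:R)).
by apply: cvgM; [exact: cvg_cst|exact: MX0].
Unshelve. all: by end_near. Qed.
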